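(* There exists a canonical routing labeling scheme for rooted trees on $n$ nodes with labels of length $\log n+\mathcal{O}\big((\log n)^{3/4}\sqrt{\log\log n}\big)$ bits.
   Context: All logarithms are base $2$. A (designer-port) routing labeling scheme for a family $\mathcal{T}$ of rooted trees consists of an encoder and a decoder. - The encoder is given $T\in\mathcal{T}$. It assigns a binary string (label) $\ell(u)$ to every node $u$. It also labels the edges from each node $u$ to its $\deg(u)$ children with distinct port numbers from $\{1,\dots,\deg(u)\}$; the encoder is free to choose these port numbers. - The decoder receives only $\ell(u)$ and $\ell(w)$ for nodes $u\neq w$ of some $T\in\mathcal{T}$; the value $\lceil\log n\rceil$, where $n=|T|$, may also be assumed known. It must return $0$ if the next node on the path from $u$ to $w$ is the parent of $u$. Otherwise it must return the port number of the first edge on that path. - The length of the scheme is the maximum label length over all trees in $\mathcal{T}$ and all their nodes. A port assignment is canonical if, for every node $v$ with children $v_1,\dots,v_i$ ordered so that $|T_{v_1}|\ge\dots\ge|T_{v_i}|$, the edge from $v$ to $v_j$ gets port $j$. Here $T_v$ denotes the subtree rooted at $v$; ties may be broken arbitrarily. A scheme is canonical if its encoder always produces a canonical port assignment. *)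

(* Defs.v *)
From Stdlib Require Import Reals.
From mathcomp Require Import all_boot.

Record rtree := RTree {
  tn : nat;
  troot : 'I_tn;
  tpar : 'I_tn -> 'I_tn;
  tpar_root : tpar troot = troot;
  tpar_reach : forall v : 'I_tn, exists k, iter k tpar v = troot
}.

Set Implicit Arguments.
Unset Strict Implicit.
Unset Printing Implicit Defensive.

Definition children (T : rtree) (v : 'I_(tn T)) : {set 'I_(tn T)} :=
  [set c | (c != troot T) && (tpar T c == v)].

Definition deg (T : rtree) (v : 'I_(tn T)) : nat := #|children v|.

Definition subtree (T : rtree) (v : 'I_(tn T)) : {set 'I_(tn T)} :=
  [set u | fconnect (tpar T) u v].

(* port p c = port number of the edge from the parent of c to c (c non-root).
   Valid port assignment: for each node v, the edges to its deg v children get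
   distinct ports from {1,...,deg v}. *)
Definition valid_ports (T : rtree) (port : 'I_(tn T) -> nat) : Prop :=
  (forall c, c != troot T -> 1 <= port c <= deg (tpar T c)) /\
  (forall c1 c2, c1 != troot T -> c2 != troot T -> tpar T c1 = tpar T c2 ->
      port c1 = port c2 -> c1 = c2).

(* Canonical: children with strictly larger subtrees get strictly smaller
   ports (together with validity, the port of the j-th child in nonincreasing
   subtree-size order, ties broken arbitrarily, is j). *)
Definition canonical_ports (T : rtree) (port : 'I_(tn T) -> nat) : Prop :=
  forall c1 c2, c1 != troot T -> c2 != troot T -> tpar T c1 = tpar T c2 ->
    #|subtree c2| < #|subtree c1| -> port c1 < port c2.

(* Correct routing answer a from u to w (u <> w): 0 if the next node on the
   path is the parent of u (i.e. w is not in T_u), otherwise the port of the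
   first edge, i.e. of the child c of u whose subtree contains w. *)
Definition route_ok (T : rtree) (port : 'I_(tn T) -> nat)
    (u w : 'I_(tn T)) (a : nat) : Prop :=
  (w \notin subtree u /\ a = 0) \/
  (exists c, [/\ c \in children u, w \in subtree c & a = port c]).

(* An encoder assigns labels and ports; the decoder sees two labels and
   ceil(log n) = up_log 2 n. *)
Definition encoder := forall T : rtree, ('I_(tn T) -> bitseq) * ('I_(tn T) -> nat).
Definition decoder := bitseq -> bitseq -> nat -> nat.

Definition routing_scheme (enc : encoder) (dec : decoder) : Prop :=
  (forall T : rtree, valid_ports (enc T).2) /\
  (forall (T : rtree) (u w : 'I_(tn T)), u != w ->
     route_ok (enc T).2 u w (dec ((enc T).1 u) ((enc T).1 w) (up_log 2 (tn T)))).

Definition canonical_scheme (enc : encoder) : Prop :=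
  forall T : rtree, canonical_ports (enc T).2.

Local Open Scope R_scope.

Definition log2 (x : R) : R := ln x / ln 2.

Definition len_bound (C : R) (n : nat) : R :=
  log2 (INR n) + C * Rpower (log2 (INR n)) (3/4) * sqrt (log2 (log2 (INR n))).

(* Main.v *)
Require Import Defs.
From Stdlib Require Import Reals Lra.
From mathcomp Require Import all_boot.
From mathcomp Require Import zify.

Set Implicit Arguments.
Unset Strict Implicit.
Unset Printing Implicit Defensive.

(** Every node [v] receives an integer position so that its subtree occupies
an interval starting there: first [v] itself, then the light subtrees in port
order, then the subtree of the heaviest child (port 1). A subtree of size [s]
gets about [s * budget s] positions, with [budget] growing by a factor
[1 + 1/q0] at each doubling; since a light subtree has at most half the size,
this growth pays for rounding each length up by a factor [1 + O(1/q0)]. A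
label contains the position, a rounding of the length of the occupied
interval (deciding ancestry), and a code for the layout of the light
subtrees. As canonical ports sort the subtrees by size, the rounded lengths
of the first [2^k] light subtrees are nonincreasing, and counting the lengths
above each of [O(q0 * k)] thresholds describes them in [O(q0 * k^2)] bits. The
other light subtrees are smaller than the total by a factor [2^k], so with
[k] about [q0 * log log n] they can afford the crude bound total/index on
their size, which needs no code. Overall the label takes
[log n + O(log n / q0 + q0^3 * (log log n)^2)] bits, and one chooses [q0] near
[(log n)^(1/4) / sqrt (log log n)]. *)

(** * Binary codes of fixed width for a finite type *)

Section BitCode.
Variables (T : finType) (w : nat).

(** Elements are matched by rank with the words of length [w]; when these suffice, all codes have
    the same length. *)
Definition bits (x : T) : bitseq :=
  nth [::] [seq val t | t <- enum {: w.-tuple bool}] (enum_rank x).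

Definition unbits (s : bitseq) : option T := [pick x | bits x == s].

Hypothesis leTw : #|T| <= 2 ^ w.

Let rank_lt (x : T) : enum_rank x < size (enum {: w.-tuple bool}).
Proof. by rewrite -cardE card_tuple card_bool (leq_trans _ leTw). Qed.

Lemma size_bits x : size (bits x) = w.
Proof.
rewrite /bits.
have := mem_nth [::] (s := [seq val t | t <- enum {: w.-tuple bool}]) (n := enum_rank x).
by rewrite size_map rank_lt => /(_ isT) /mapP[t _ ->]; rewrite size_tuple.
Qed.

Lemma bitsK : pcancel bits unbits.
Proof.
move=> x; rewrite /unbits; case: pickP => [z /eqP zx | /(_ x)]; last by rewrite eqxx.
congr Some; apply: enum_rank_inj; apply: val_inj; apply/eqP.
rewrite -(@nth_uniq _ [::] [seq val t | t <- enum {: w.-tuple bool}]).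
- by apply/eqP.
- by rewrite size_map; apply: rank_lt.
- by rewrite size_map; apply: rank_lt.
- by rewrite (map_inj_uniq val_inj) enum_uniq.
Qed.

End BitCode.

(** * Rounding to a geometric grid *)

(* A grid of ratio about [1 + 1/q], used to round numbers above [b]. *)
Definition grid (q b t : nat) : nat := iter t (fun x => (x + x %/ q).+1) b.

Lemma grid_ge q b t : t <= grid q b t.
Proof.
elim: t => // t IH; apply: (leq_ltn_trans IH).
by rewrite /grid /= ltnS leq_addr.
Qed.

Lemma grid_unbounded q b s : exists t, s <= grid q b t.
Proof. by exists s; apply: grid_ge. Qed.

Definition grid_index (q b s : nat) : nat := ex_minn (grid_unbounded q b s).

Lemma grid_indexP q b s : s <= grid q b (grid_index q b s).
Proof. by rewrite /grid_index; case: ex_minnP. Qed.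

Lemma grid_index_le q b s t : s <= grid q b t -> grid_index q b s <= t.
Proof. by rewrite /grid_index; case: ex_minnP => m _ H /H. Qed.

Lemma grid_index_mono q b s s' : s <= s' -> grid_index q b s <= grid_index q b s'.
Proof. by move=> ss'; apply/grid_index_le/(leq_trans ss')/grid_indexP. Qed.

Lemma grid_index_gt0 q b s : (0 < grid_index q b s) = (b < s).
Proof.
apply/idP/idP => [|bs]; last first.
  rewrite lt0n; apply/eqP => e; have := grid_indexP q b s; rewrite e /grid /=; lia.
by apply: contraTT; rewrite -leqNgt => sb; rewrite -leqNgt; apply: (@grid_index_le _ _ _ 0).
Qed.

(** The preceding grid point is strictly below [s], which absorbs the successor in a grid step. *)
Lemma grid_roundup q b s : b < s ->
  grid q b (grid_index q b s) <= s + s %/ q.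
Proof.
rewrite -(grid_index_gt0 q); case E: (grid_index q b s) => [//|t] _.
have lt_t : grid q b t < s.
  by rewrite ltnNge; apply/negP => /grid_index_le; rewrite E ltnn.
have := leq_div2r q (ltnW lt_t); rewrite /grid /= -/(grid q b t).
by move=> h; rewrite -addSn; apply: leq_add.
Qed.

(** The successor in a step makes up for the floor in [x %/ q]. *)
Lemma grid_step q b t : 0 < q -> q.+1 * grid q b t <= q * grid q b t.+1.
Proof.
move=> q0; rewrite /grid /= -/(grid q b t); set x := grid _ _ _.
have := ltn_ceil x q0; rewrite (mulnC _ q); nia.
Qed.

Lemma grid_homo q b t t' : t <= t' -> grid q b t <= grid q b t'.
Proof.
move=> /subnK <-; elim: (t' - t) => //= n IH.
by apply: (leq_trans IH); rewrite /grid /= leqW // leq_addr.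
Qed.

(** Each of the [q] steps adds at least a fraction [1 / q] of the initial value. *)
Lemma grid_double q b t : 0 < q -> 2 * grid q b t <= grid q b (t + q).
Proof.
move=> q0; have H j : q * grid q b t + j * grid q b t <= q * grid q b (t + j).
  elim: j => [|j IH]; first by rewrite addn0 mul0n addn0.
  have h1 := grid_step b (t + j) q0.
  have h2 := grid_homo q b (leq_addr j t).
  rewrite addnS; nia.
by have := H q; nia.
Qed.

Lemma grid_exp q b t j : 0 < q -> 2 ^ j * grid q b t <= grid q b (t + q * j).
Proof.
move=> q0; elim: j => [|j IH]; first by rewrite muln0 addn0 mul1n.
have := grid_double b (t + q * j) q0.
rewrite expnS -mulnA mulnS (addnC q) addnA; apply: leq_trans.
by rewrite leq_mul2l.
Qed.

(** The first step leads from [b] to at least [b.+1], also for [b = 0]; after it, [q] steps suffice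
    per doubling. *)
Lemma grid_index_bound q b s j : 0 < q -> s <= 2 ^ j * b.+1 ->
  grid_index q b s <= (q * j).+1.
Proof.
move=> q0 sb; apply: grid_index_le.
have := grid_exp b 1 j q0; rewrite add1n; apply: leq_trans; apply: (leq_trans sb).
by rewrite leq_mul2l /grid /= ltnS leq_addr orbT.
Qed.

(** * Counts and sums of monotone sequences *)

Lemma count_initial (p : pred nat) P j :
  (forall a b, a <= b -> p b -> p a) -> (j < count p (iota 0 P)) = (j < P) && p j.
Proof.
move=> dp; elim: P => [|P IH]; first by [].
rewrite -[in iota _ _]addn1 iotaD count_cat /= addn0 add0n.
case pP: (p P).
  have -> : count p (iota 0 P) = P.
    rewrite -[RHS](size_iota 0 P); apply/eqP; rewrite -all_count; apply/allP => a.
    by rewrite mem_iota => /andP[_ aP]; apply: (dp _ _ _ pP); exact: ltnW.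
  rewrite addn1; case: (ltnP j P.+1) => //= jP; apply/esym; apply: (dp _ _ _ pP); lia.
rewrite addn0 IH; case: (ltngtP j P) => [jP|jP|->] /=.
- by have -> : j < P.+1 by lia.
- by have -> : (j < P.+1) = false by lia.
- by rewrite pP andbF.
Qed.

Lemma count_lt c K : count (fun i => i < c) (iota 0 K) = minn c K.
Proof.
elim: K => [|K IH]; first by rewrite minn0.
rewrite -[in iota _ _]addn1 iotaD count_cat /= IH; lia.
Qed.

(** Conjugating a partition twice gives it back. A code can thus store [K] counts, one per
    threshold, in place of [P] values. *)
Lemma count_level (c : nat -> nat) P K j :
  (forall a b, a <= b -> c b <= c a) -> (forall a, c a <= K) ->
  (forall a, P <= a -> c a = 0) ->
  count (fun i => j < count (fun a => i < c a) (iota 0 P)) (iota 0 K) = c j.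
Proof.
move=> mc cK c0.
rewrite (@eq_count _ _ (fun i => i < c j)); last first.
  move=> i; rewrite count_initial; last by move=> a b /mc; lia.
  by case: (ltnP j P) => // /c0 ->.
by rewrite count_lt (minn_idPl (cK j)).
Qed.

(** Each dyadic block of indices contributes at most the numerator. The inner claim separates the
    numerator from the range, so that induction over the blocks applies. *)
Lemma harmonic_sum e : \sum_(0 <= j < 2 ^ e) 2 ^ e %/ j.+1 <= e.+1 * 2 ^ e.
Proof.
have H m N : 0 < N -> \sum_(0 <= j < 2 ^ m) N %/ j.+1 <= m.+1 * N.
  move=> N0; elim: m => [|m IH].
    by rewrite expn0 big_nat1 divn1 mul1n.
  rewrite (@big_cat_nat _ _ _ (2 ^ m)) //=; last by rewrite leq_exp2l.
  rewrite mulSn addnC; apply: leq_add => //.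
  have E : \sum_(2 ^ m <= i < 2 ^ m.+1) N %/ i.+1 <= \sum_(2 ^ m <= i < 2 ^ m.+1) N %/ 2 ^ m.
    rewrite big_nat [leqRHS]big_nat; apply: leq_sum => i /andP[hi _].
    by apply: leq_div2l; [rewrite expn_gt0 | apply: leqW].
  apply: (leq_trans E); rewrite sum_nat_const_nat expnS mul2n -addnn addnK mulnC.
  exact: leq_trunc_div.
by apply: H; rewrite expn_gt0.
Qed.

(** The default 0 of [nth] pads the list with zeros, so the indices need no bound. *)
Definition antitone_seq (s : seq nat) := forall a b, a <= b -> nth 0 s b <= nth 0 s a.

Lemma sumn_nth (s : seq nat) N : size s <= N -> sumn s = \sum_(0 <= i < N) nth 0 s i.
Proof.
move=> sN; rewrite sumnE (big_nth 0) [RHS](@big_cat_nat _ _ _ (size s)) //=.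
rewrite [X in _ + X]big_nat [X in _ + X]big1 ?addn0 // => i /andP[si _].
by rewrite nth_default.
Qed.

(** The first [j.+1] entries are all at least entry [j]. This is the bound on sizes that needs no
    code. *)
Lemma antitone_nth_bound (s : seq nat) j :
  antitone_seq s -> j.+1 * nth 0 s j <= sumn s.
Proof.
move=> anti; rewrite (@sumn_nth s (size s + j.+1)) ?leq_addr //.
rewrite (@big_cat_nat _ _ _ j.+1) //= ?leq_addl //.
apply: leq_trans (leq_addr _ _).
rewrite -[X in X * _]subn0 -sum_nat_const_nat big_nat [leqRHS]big_nat.
by apply: leq_sum => i /andP[_ ij]; apply: anti.
Qed.

(** * Layout of the light subtrees *)

Section Shape.

Variables (q0 l : nat).
Hypothesis q0_gt0 : 0 < q0.

(** Rounding is ten times finer than growth, so that the roundings of a big length together cost at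
    most half of one growth step. *)
Definition prec := 10 * q0.
Definition growth i := grid q0 prec i.
Definition budget n := growth (trunc_log 2 n).+1.
(** The first [2 ^ tablog] light children may have their size class recorded. Growth at least
    doubles every [q0] steps, so a size smaller by [2 ^ tablog] has a budget smaller by about
    [2 ^ tabdrop]; this outweighs a harmonic loss of order [l] and leaves only a fraction of
    [1 / q0]. *)
Definition tabdrop := up_log 2 (30 * q0 * l.+1).
Definition tablog := (q0 * tabdrop).+1.
Definition tabsize := (prec * tablog).+1.

(* The child with index [j] among the light children has size at most
   [2 ^ e %/ j.+1], where [2 ^ e] is at least the total light size. *)
Definition small_len e j :=
  let B := 2 ^ e %/ maxn j.+1 (2 ^ tablog) in 2 * B * budget B.
(* [c] is the class of the child size in the grid starting at [2 ^ (e - k)],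
   class 0 meaning that [small_len] suffices. *)
Definition big_len e i c :=
  if c == 0 then 0 else
  let z := grid prec (2 ^ e %/ 2 ^ tablog) c * growth i in z + z %/ prec + 1.
(* The leading 1 is the place of the parent itself. *)
Definition lens e i (c : nat -> nat) :=
  1 :: [seq small_len e j + big_len e i (c j) | j <- iota 0 (2 ^ e)].
Definition class e s j :=
  if j < 2 ^ tablog then grid_index prec (2 ^ e %/ 2 ^ tablog) (nth 0 s j) else 0.

Let prec_gt0 : 0 < prec. Proof. by rewrite muln_gt0. Qed.

Lemma growth_homo i j : i <= j -> growth i <= growth j.
Proof. exact: grid_homo. Qed.

Lemma budget_homo m n : m <= n -> budget m <= budget n.
Proof. by move=> mn; apply: growth_homo; rewrite ltnS leq_trunc_log. Qed.

Lemma growth_ge i : prec <= growth i.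
Proof. exact: (@growth_homo 0). Qed.

Lemma growth_succ i : growth i.+1 <= 3 * growth i.
Proof.
have h := growth_ge i; have h2 := leq_div (growth i) q0.
have e : growth i.+1 = (growth i + growth i %/ q0).+1 by [].
rewrite e; have := prec_gt0; lia.
Qed.

Section Fixed.
Variables (n : nat) (s : seq nat).
Hypothesis anti : antitone_seq s.
Hypothesis s_gt0 : forall j, j < size s -> 0 < nth 0 s j.
Hypothesis s_half : forall j, 2 * nth 0 s j <= n.
Let e := up_log 2 (sumn s).+1.
Let i := trunc_log 2 n.

Let sum_le_e : (sumn s).+1 <= 2 ^ e.
Proof. exact: up_logP. Qed.

Let e_le_sum : 2 ^ e <= 2 * (sumn s).+1.
Proof.
rewrite /e; case E: (sumn s) => [|m] //.
have := @up_log_gtn 2 m.+2 isT isT; case: (up_log 2 m.+2) => [|u] /=; first by [].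
by rewrite expnS => /ltnW; rewrite leq_mul2l.
Qed.

Lemma size_le_pow : size s <= 2 ^ e.
Proof.
apply: leq_trans sum_le_e; apply: leqW.
have H : forall j, j < size s -> 1 <= nth 0 s j by exact: s_gt0.
elim: (s) H => //= x s' IH H; have := H 0 isT; have := IH (fun j => H j.+1) => /=; lia.
Qed.

(** Half the size means a logarithm smaller by one, so a light child is paid for one growth step
    below [budget n]. *)
Let budget_half j : 0 < nth 0 s j -> budget (nth 0 s j) <= growth i.
Proof.
move=> sj; apply: growth_homo; apply: trunc_log_max => //.
by apply: leq_trans (s_half j); rewrite expnS leq_mul2l trunc_logP.
Qed.

(** In class 0 the size is at most [B], by the grid base inside the table and by total over rank
    beyond it; the factor 2 is ample. In a positive class the grid rounds the size up and
    [z %/ prec + 1] supplies the factor [1 + 1 / prec]. That factor is later spent on rounding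
    extents. *)
Lemma lens_cover j : j < size s ->
  prec.+1 * (nth 0 s j * budget (nth 0 s j)) <=
  prec * nth 0 (lens e i (class e s)) j.+1.
Proof.
move=> js; have sj := s_gt0 js.
rewrite /= (nth_map 0) ?size_iota ?(leq_trans js size_le_pow) //
  nth_iota ?(leq_trans js size_le_pow) //.
rewrite add0n mulnDr.
have [c0|cp] := posnP (class e s j).
  apply: leq_trans (leq_addr _ _); rewrite /small_len.
  set B := _ %/ _.
  have sB : nth 0 s j <= B.
    rewrite /B; move: c0; rewrite /class; case: ltnP => [jP|Pj] c0.
      rewrite (maxn_idPr jP); have := grid_indexP prec (2 ^ e %/ 2 ^ tablog) (nth 0 s j).
      by rewrite c0.
    rewrite (maxn_idPl _); last by apply: leqW.
    rewrite leq_divRL // mulnC; apply: leq_trans (ltnW sum_le_e).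
    exact: antitone_nth_bound.
  have h : nth 0 s j * budget (nth 0 s j) <= B * budget B.
    by apply: leq_mul => //; apply: budget_homo.
  have := prec_gt0; nia.
apply: leq_trans (leq_addl _ _).
rewrite /big_len -(negbK (_ == 0)) -lt0n cp /=; set z := _ * growth i.
have sz : nth 0 s j * budget (nth 0 s j) <= z.
  apply: leq_mul; last exact: budget_half.
  by move: cp; rewrite /class; case: (ltnP j) => // _ _; apply: grid_indexP.
apply: (@leq_trans (prec.+1 * z)); first by rewrite leq_mul2l sz orbT.
have := ltn_ceil z prec_gt0; move: (z %/ prec) => d; lia.
Qed.

Hypothesis s_n : (sumn s).+1 <= n.
Hypothesis n_l : n <= 2 ^ l.

(** Rounding the size costs a factor [1 + 1 / prec], and the terms added to [z] cost [1 + 2 / prec]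
    because [prec <= z]. The product is at most [1 + 5 / prec = 1 + 1 / (2 * q0)]. *)
Let sum_big : 2 * q0 * \sum_(0 <= j < 2 ^ e) big_len e i (class e s j) <=
  (2 * q0).+1 * growth i * sumn s.
Proof.
rewrite (sumn_nth size_le_pow) !big_distrr /=; apply: leq_sum => j _.
rewrite /big_len; case: (posnP (class e s j)) => [_|]; first by rewrite muln0.
rewrite /class; case: (ltnP j) => // _ cp.
have sb : 2 ^ e %/ 2 ^ tablog < nth 0 s j by rewrite -(grid_index_gt0 prec).
have := grid_roundup prec sb; move: cp; set c := grid_index _ _ _ => cp vs.
set v := grid _ _ c in vs *.
have v1 : 0 < v by apply: leq_trans (grid_ge _ _ _).
have g := growth_ge i; set y := growth i in g *.
set z := v * y; have zq := leq_trunc_div z prec.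
have sq := leq_trunc_div (nth 0 s j) prec.
have v2 : prec * v <= prec.+1 * nth 0 s j by nia.
have z1 : prec <= z by rewrite -[prec]mul1n; apply: leq_mul.
set R := z + _ + 1.
have r1 : prec * R <= prec.+2 * z by rewrite /R; nia.
have r2 : prec * (prec * R) <= prec.+2 * (prec.+1 * nth 0 s j * y).
  apply: (@leq_trans (prec * (prec.+2 * z))); first by rewrite leq_mul2l r1 orbT.
  by rewrite mulnCA leq_mul2l /= /z mulnA leq_mul2r v2 orbT.
have r3 : prec * R <= (prec + 5) * (nth 0 s j * y).
  rewrite -(leq_pmul2l prec_gt0); apply: (leq_trans r2).
  rewrite -mulnA !(mulnA _ _ (_ * y)) leq_mul2r; apply/orP; right.
  have := prec_gt0; nia.
move: r3; rewrite {1 2}/prec; nia.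
Qed.

(* The harmonic loss [e.+1] is absorbed because the budget of a subtree
   smaller by [2 ^ tablog] is smaller by the factor [2 ^ tabdrop]. *)
Let sum_small : 2 ^ tabdrop * \sum_(0 <= j < 2 ^ e) small_len e j <=
  4 * l.+1 * (sumn s).+1 * budget n.
Proof.
have el : e <= l by apply: up_log_min => //; apply: leq_trans n_l.
set b := 2 ^ e %/ 2 ^ tablog.
have h1 : \sum_(0 <= j < 2 ^ e) small_len e j <= 2 * (e.+1 * 2 ^ e) * budget b.
  apply: (@leq_trans (2 * (\sum_(0 <= j < 2 ^ e) 2 ^ e %/ j.+1) * budget b)); last first.
    by rewrite leq_mul2r leq_mul2l harmonic_sum orbT.
  rewrite big_distrr big_distrl /=; apply: leq_sum => j _; rewrite /small_len.
  apply: leq_mul.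
    by rewrite leq_mul2l; apply: leq_div2l; rewrite ?leq_maxl.
  by apply: budget_homo; apply: leq_div2l; rewrite ?expn_gt0 ?leq_maxr.
case: (posnP b) => [b0|b_gt0].
  rewrite big1 ?muln0 // => j _; rewrite /small_len; set B := _ %/ _.
  suff -> : B = 0 by [].
  apply/eqP; rewrite -leqn0 -b0; apply: leq_div2l; rewrite ?expn_gt0 ?leq_maxr //.
have ke : tablog <= e.
  by move: b_gt0; rewrite divn_gt0 ?expn_gt0 // leq_exp2l.
have be : b = 2 ^ (e - tablog) by rewrite /b expnB.
have e1 : e.-1 <= trunc_log 2 n.
  apply: trunc_log_max => //; rewrite -(leq_pmul2l (isT : 0 < 2)) -expnS.
  rewrite prednK; last exact: leq_trans ke.
  by apply: (leq_trans e_le_sum); rewrite leq_mul2l.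
(* Here [2 ^ e] may exceed [n], though only [e.-1] is at most its logarithm; the successor in
   [tablog] compensates. *)
have h2 : 2 ^ tabdrop * budget b <= budget n.
  apply: leq_trans (grid_exp _ _ _ q0_gt0) _; apply: grid_homo.
  rewrite be trunc_expnK //; move: e1 ke; rewrite /tablog; lia.
apply: (@leq_trans (2 ^ tabdrop * (2 * (e.+1 * 2 ^ e) * budget b))).
  by rewrite leq_mul2l h1 orbT.
rewrite mulnCA; apply: leq_mul => //.
rewrite mulnA (_ : 4 * l.+1 * _ = 2 * l.+1 * (2 * (sumn s).+1)); last by lia.
by apply: leq_mul => //; rewrite leq_mul2l ltnS el.
Qed.

(** With [U = t.+1 * y], one growth step provides a slack of [U / q0]. The big lengths use half of
    it; of the other half, the small lengths use four fifths and the leading 1 one fifth. *)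
Lemma lens_total : sumn (lens e i (class e s)) <= (sumn s).+1 * budget n.
Proof.
rewrite /= sumnE big_map -[X in iota _ X]subn0 -/(index_iota 0 (2 ^ e)) big_split /=.
move: sum_small sum_big; set S := \sum_(0 <= j < 2 ^ e) small_len e j.
set R := \sum_(_ <= _ < _) _; set t := sumn s.
have g0 := growth_ge i.
have g1 := growth_succ i.
have g2 := grid_step prec i q0_gt0.
rewrite -[budget n]/(growth i.+1) in g1 g2 *.
rewrite -!/(growth _) in g2.
move: g0 g1 g2; set y := growth i; set y' := growth i.+1 => g0 g1 g2 hS hR.
have kap : 30 * q0 * l.+1 <= 2 ^ tabdrop by apply: up_logP.
have hS' : 5 * (2 * q0 * S) <= 4 * (t.+1 * y).
  have p0 : 0 < 2 ^ tabdrop by rewrite expn_gt0.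
  rewrite -(leq_pmul2l p0).
  (* The 30 in [tabdrop] is this 10 times the factor 3 from [growth_succ]. *)
  have a1 : 2 ^ tabdrop * (5 * (2 * q0 * S)) <= 10 * q0 * (4 * l.+1 * t.+1 * (3 * y)).
    rewrite (_ : _ * (5 * _) = 10 * q0 * (2 ^ tabdrop * S)); last by lia.
    rewrite leq_mul2l; apply/orP; right; apply: (leq_trans hS).
    by rewrite leq_mul2l g1 orbT.
  apply: (leq_trans a1).
  rewrite (_ : 10 * q0 * _ = 30 * q0 * l.+1 * (4 * (t.+1 * y))); last by lia.
  by rewrite leq_mul2r kap orbT.
have h1 : 5 * (2 * q0) <= t.+1 * y.
  by move: g0; rewrite /prec; nia.
have hR' : 2 * q0 * R <= (2 * q0).+1 * (t.+1 * y).
  by apply: (leq_trans hR); rewrite -mulnA leq_mul // [leqLHS]mulnC leq_mul.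
have hy : t.+1 * (q0.+1 * y) <= q0 * (t.+1 * y') by rewrite [leqRHS]mulnCA leq_mul2l g2.
move: hS' h1 hR' hy; rewrite (mulnCA t.+1) [q0 * (_ * y')]mulnC.
set U := t.+1 * y => hS' h1 hR' hy.
rewrite -(leq_pmul2l q0_gt0) (mulnC _ (_ * y')); apply: leq_trans hy.
move: hS' h1 hR'; clear; lia.
Qed.

End Fixed.
End Shape.

(** * Coding the layout by threshold counts *)

Section Code.

Variables (q0 l : nat).
Hypothesis q0_gt0 : 0 < q0.

(* The finite function stores, for each class, the number of light children
   whose class is larger. *)
Definition code := ('I_l.+1 * 'I_l.+1 * {ffun 'I_(tabsize q0 l) -> 'I_(2 ^ tablog q0 l).+1})%type.

Definition code_shape (x : code) : seq nat :=
  lens q0 l x.1.1 x.1.2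
    (fun j => count (fun i => j < x.2 (inord i)) (iota 0 (tabsize q0 l))).

Definition encode (n : nat) (s : seq nat) : code :=
  let e := up_log 2 (sumn s).+1 in
  (inord e, inord (trunc_log 2 n),
   [ffun i : 'I_(tabsize q0 l) => inord
      (count (fun a => i < class q0 l e s a) (iota 0 (2 ^ tablog q0 l)))]).

(** Classes are nonincreasing, bounded by [tabsize] and zero beyond the table, so [count_level]
    recovers them from the counts. *)
Lemma shape_encode n s :
  antitone_seq s -> (sumn s).+1 <= n -> n <= 2 ^ l ->
  code_shape (encode n s) =
  lens q0 l (up_log 2 (sumn s).+1) (trunc_log 2 n) (class q0 l (up_log 2 (sumn s).+1) s).
Proof.
move=> anti sn nl; rewrite /code_shape /encode; cbn [fst snd]; rewrite !inordK; first last.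
- by rewrite ltnS up_log_min //; apply: leq_trans nl.
- rewrite ltnS -(leq_exp2l _ _ (isT : 1 < 2)); apply: leq_trans nl.
  by apply: trunc_logP => //; apply: leq_trans sn.
rewrite /lens; congr (_ :: _); apply: eq_map => j; congr (_ + big_len _ _ _ _ _).
set e := up_log _ _.
rewrite -[RHS](@count_level (class q0 l e s) (2 ^ tablog q0 l) (tabsize q0 l) j).
- apply: eq_in_count => i; rewrite mem_iota add0n => /andP[_ iK].
  rewrite ffunE !inordK //.
  by rewrite ltnS; apply: leq_trans (count_size _ _) _; rewrite size_iota.
- move=> a b ab; rewrite /class; case: (ltnP b) => // bP.
  by rewrite (leq_ltn_trans ab bP); apply/grid_index_mono/anti.
- move=> a; rewrite /class; case: (ltnP a) => // _.
  (* Each size is at most [2 ^ e], which is below [2 ^ tablog] times the successor of the grid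
     base. *)
  apply: grid_index_bound; first by rewrite muln_gt0.
  apply: (@leq_trans (2 ^ e)).
    apply: leq_trans (up_logP _ (isT : 1 < 2)); apply: leqW.
    by apply: leq_trans (antitone_nth_bound a anti); rewrite leq_pmull.
  by apply: ltnW; rewrite mulnC ltn_ceil // expn_gt0.
- by move=> a; rewrite /class; case: (ltnP a).
Qed.

End Code.

(** * Positions in a rooted tree *)

Section Tree.
Variable T : rtree.
Implicit Types u v w c : 'I_(tn T).
Local Notation par := (tpar T).
Local Notation root := (troot T).

Lemma iter_root k : iter k par root = root.
Proof. by elim: k => //= k ->; apply: (tpar_root T). Qed.

(** Going round the cycle often enough takes more steps than [v] needs to reach the root, where the
    walk stays. *)
Lemma par_acyclic k v : iter k.+1 par v = v -> v = root.
Proof.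
move=> cyc; have [m vm] := tpar_reach T v.
have H j : iter (j * k.+1) par v = v by elim: j => // j IH; rewrite mulSn iterD IH.
have := H m; rewrite -(@subnK m (m * k.+1)) ?leq_pmulr // iterD vm iter_root.
by move=> <-.
Qed.

Lemma iter_tn v : iter (tn T) par v = root.
Proof.
have [m vm] := tpar_reach T v.
have cn : fconnect par v root by rewrite -vm fconnect_iter.
have lt : findex par v root <= tn T.
  by apply: ltnW; apply: leq_trans (findex_max cn) _; rewrite -[leqRHS]card_ord max_card.
have H k : findex par v root <= k -> iter k par v = root.
  by move=> /subnK <-; rewrite iterD iter_findex // iter_root.
exact: H.
Qed.

Lemma in_subtree u v : u \in subtree v <-> exists k, iter k par u = v.
Proof.
rewrite inE; split=> [uv | [k <-]]; last exact: fconnect_iter.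
by exists (findex par u v); apply: iter_findex.
Qed.

Lemma in_children c v : (c \in children v) = (c != root) && (par c == v).
Proof. by rewrite inE. Qed.

Lemma subtree_refl v : v \in subtree v.
Proof. by rewrite inE connect0. Qed.

Lemma subtree_trans u v w : w \in subtree u -> u \in subtree v -> w \in subtree v.
Proof. by rewrite !inE; apply: connect_trans. Qed.

Lemma child_subtree c v : c \in children v -> c \in subtree v.
Proof. by rewrite in_children => /andP[_ /eqP <-]; apply/in_subtree; exists 1. Qed.

Lemma notin_child_subtree c v : c \in children v -> v \notin subtree c.
Proof.
rewrite in_children => /andP[cr /eqP pc]; apply/negP => /in_subtree[k ck].
by move/eqP: cr; apply; apply: (@par_acyclic k); rewrite iterSr pc.
Qed.

Lemma subtree_child w v : w \in subtree v -> w != v ->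
  exists2 c, c \in children v & w \in subtree c.
Proof.
move=> /in_subtree[k0 wk0] wv.
have ex : exists k, iter k par w == v by exists k0; apply/eqP.
case: (ex_minnP ex) => -[|k] /eqP wk min; first by rewrite -wk eqxx in wv.
exists (iter k par w); last by apply/in_subtree; exists k.
rewrite in_children -wk eqxx andbT; apply/eqP => wr.
suff : k.+1 <= k by rewrite ltnn.
by apply: min; rewrite -wk /= wr tpar_root.
Qed.

(** The ancestors of [w] form a chain; two distinct children on it would put [v] on a cycle. *)
Lemma child_unique w v c1 c2 : c1 \in children v -> c2 \in children v ->
  w \in subtree c1 -> w \in subtree c2 -> c1 = c2.
Proof.
move=> h1 h2 /in_subtree[k1 w1] /in_subtree[k2 w2].
wlog k12 : c1 c2 k1 k2 h1 h2 w1 w2 / k1 <= k2.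
  move=> H; case: (leqP k1 k2) => k12; first exact: (H _ _ k1 k2).
  by apply/esym; apply: (H _ _ k2 k1) => //; apply: ltnW.
have e : iter (k2 - k1) par c1 = c2 by rewrite -w1 -iterD subnK.
case: (k2 - k1) e => // d; rewrite iterSr.
move: h1 h2; rewrite !in_children => /andP[_ /eqP->] /andP[c2r /eqP pc2] e.
have vr : v = root by apply: (@par_acyclic d); rewrite iterS e.
by rewrite -e vr iter_root eqxx in c2r.
Qed.

Lemma card_subtree_le v : #|subtree v| <= tn T.
Proof. by have := max_card (mem (subtree v)); rewrite card_ord. Qed.

Lemma card_subtree v : #|subtree v| = (\sum_(c in children v) #|subtree c|).+1.
Proof.
rewrite (cardsD1 v) subtree_refl add1n; congr _.+1.
under eq_bigr do rewrite -sum1_card big_mkcond.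
rewrite exchange_big -sum1_card big_mkcond /=; apply: eq_bigr => w _.
rewrite in_setD1; case: (boolP (w == v)) => [/eqP->|wv] /=.
  rewrite big1 // => c cv; by rewrite (negbTE (notin_child_subtree cv)).
case: (boolP (w \in subtree v)) => [wT|wT].
  have [c cv wc] := subtree_child wT wv.
  rewrite (bigD1 c) //= wc big1 ?addn0 // => c' /andP[c'v c'c].
  by case: ifP => // wc'; rewrite (child_unique c'v cv wc' wc) eqxx in c'c.
rewrite big1 // => c cv; case: ifP => // wc.
by rewrite (subtree_trans wc (child_subtree cv)) in wT.
Qed.

Definition kids v : seq 'I_(tn T) :=
  sort (fun c1 c2 => #|subtree c2| <= #|subtree c1|) (enum (children v)).

Definition cport c := (index c (kids (par c))).+1.

Lemma mem_kids c v : (c \in kids v) = (c \in children v).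
Proof. by rewrite mem_sort mem_enum. Qed.

Lemma size_kids v : size (kids v) = deg v.
Proof. by rewrite size_sort -cardE. Qed.

Definition child_sizes v := [seq #|subtree c| | c <- kids v].

Lemma antitone_child_sizes v : antitone_seq (child_sizes v).
Proof.
move=> a b ab; have [bs|] := ltnP b (size (kids v)); last first.
  by move=> bs; rewrite [leqLHS]nth_default // size_map.
have as_ := leq_ltn_trans ab bs.
rewrite /child_sizes !(nth_map v) //.
apply: (@sorted_leq_nth _ (fun c1 c2 => #|subtree c2| <= #|subtree c1|)) => //.
- by move=> y x z /= h1 h2; apply: leq_trans h2 h1.
- by apply: sort_sorted => x y; apply: leq_total.
Qed.

Lemma sumn_child_sizes v : #|subtree v| = (sumn (child_sizes v)).+1.
Proof.
rewrite card_subtree sumnE big_map; congr _.+1.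
rewrite -big_enum /=; apply: perm_big.
by rewrite perm_sym perm_sort.
Qed.

Lemma cport_valid : valid_ports cport.
Proof.
split=> [c cr|c1 c2 r1 r2 pp [ee]].
  by rewrite /cport /= -size_kids index_mem mem_kids in_children cr eqxx.
have m1 : c1 \in kids (par c1) by rewrite mem_kids in_children r1 eqxx.
have m2 : c2 \in kids (par c1) by rewrite mem_kids in_children r2 pp eqxx.
by rewrite -(nth_index c1 m1) ee -pp nth_index.
Qed.

Lemma cport_canonical : canonical_ports cport.
Proof.
move=> c1 c2 r1 r2 pp lt; rewrite /cport ltnS -pp ltnNge; apply/negP => le.
have m1 : c1 \in kids (par c1) by rewrite mem_kids in_children r1 eqxx.
have m2 : c2 \in kids (par c1) by rewrite mem_kids in_children r2 pp eqxx.
have := @antitone_child_sizes (par c1) _ _ le.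
rewrite /child_sizes !(nth_map c1) ?index_mem // !nth_index //.
by rewrite leqNgt lt.
Qed.

(** * Interval layout of a tree *)

Section Layout.
(** [Y] gives the places per node as a function of subtree size, [enc] and [sh] write and read
    layout codes, and [rnd] rounds extents. *)
Variables (C : Type) (q : nat) (Y : nat -> nat) (sh : C -> seq nat)
  (enc : nat -> seq nat -> C) (rnd : nat -> nat).
Hypothesis q_gt0 : 0 < q.
Hypothesis Y_gt0 : forall m, 0 < Y m.
Hypothesis Y_homo : forall m n, m <= n -> Y m <= Y n.
Hypothesis rnd_ge : forall x, x <= rnd x.
Hypothesis rnd_le : forall x, 0 < x -> q * rnd x <= q.+1 * x.
Hypothesis enc_spec : forall m s, antitone_seq s ->
  (forall j, j < size s -> 0 < nth 0 s j) -> (forall j, 2 * nth 0 s j <= m) ->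
  (sumn s).+1 <= m -> m <= tn T ->
  [/\ nth 0 (sh (enc m s)) 0 = 1,
      forall j, j < size s ->
        q.+1 * (nth 0 s j * Y (nth 0 s j)) <= q * nth 0 (sh (enc m s)) j.+1
    & sumn (sh (enc m s)) <= (sumn s).+1 * Y m].

Definition node_code v := enc #|subtree v| (behead (child_sizes v)).
Definition node_shape v := sh (node_code v).
(** Entry 0 of the shape is the place of the parent, so entry [j] belongs to the light child of
    index [j]. The heavy child, of index 0, follows all entries and needs no recorded length. *)
Definition offset c :=
  if c == root then 0 else
  let j := index c (kids (par c)) in
  if j == 0 then sumn (node_shape (par c)) else sumn (take j (node_shape (par c))).
(** The walk reaches the root within [tn T] steps and then adds only zeros. *)
Definition position v := \sum_(0 <= i < tn T) offset (iter i par v).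
Definition extent v := \max_(w in subtree v) (position w - position v).+1.

(** [reshape_index] finds the block of the shape containing [o]; block [j > 0] is the child of port
    [j.+1]. *)
Definition route (x y : nat) (r : nat) (s : seq nat) : nat :=
  if x <= y < x + r then
    let o := y - x in if sumn s <= o then 1 else (reshape_index s o).+1
  else 0.

(** The last clause holds because the shape costs at most [Y] per node for [v] and the light
    subtrees, which leaves the heavy child [Y] places per node at the rate of the parent. *)
Lemma node_spec v :
  [/\ nth 0 (node_shape v) 0 = 1,
      forall c, c \in children v -> 0 < index c (kids v) ->
        q.+1 * (#|subtree c| * Y #|subtree c|) <= q * nth 0 (node_shape v) (index c (kids v)),
      sumn (node_shape v) <= #|subtree v| * Y #|subtree v|
    & forall c, c \in children v -> index c (kids v) = 0 ->
        sumn (node_shape v) + #|subtree c| * Y #|subtree v| <= #|subtree v| * Y #|subtree v|].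
Proof.
have sv := sumn_child_sizes v; have av := @antitone_child_sizes v.
have nb j : nth 0 (behead (child_sizes v)) j = nth 0 (child_sizes v) j.+1 by rewrite nth_behead.
have [||||| h1 h2 h3] := @enc_spec #|subtree v| (behead (child_sizes v)).
- by move=> a b ab; rewrite !nb; apply: av.
- move=> j; rewrite size_behead nb /child_sizes size_map => js.
  have js' : j.+1 < size (kids v) by lia.
  rewrite (nth_map v) // card_gt0; apply/set0Pn; exists (nth v (kids v) j.+1).
  exact: subtree_refl.
(* A light size is at most the heavy size and at most the light total, hence at most half of the
   whole. *)
- move=> j; rewrite nb sv; have := av 0 j.+1 isT.
  case: (child_sizes v) => [|x s] /=; first by [].
  suff : nth 0 s j <= sumn s by lia.
  elim: s j {sv av nb} => [|y s IH] [|j] //=; first by rewrite leq_addr.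
  by apply: leq_trans (IH j) _; rewrite leq_addl.
- by rewrite sv ltnS; case: (child_sizes v) => //= x s; rewrite leq_addl.
- exact: card_subtree_le.
rewrite -/(node_code v) -/(node_shape v) in h1 h2 h3.
have nc c : c \in children v -> nth 0 (child_sizes v) (index c (kids v)) = #|subtree c|.
  by move=> cv; rewrite /child_sizes (nth_map v) ?index_mem ?mem_kids // nth_index ?mem_kids.
have hc c : c \in children v -> index c (kids v) < size (child_sizes v).
  by move=> cv; rewrite size_map index_mem mem_kids.
split=> //.
- move=> c cv; have := nc c cv; have := hc c cv; case: (index _ _) => // j jc e _.
  rewrite -e -nb; apply: h2; rewrite size_behead; lia.
- apply: (leq_trans h3); rewrite leq_mul2r; apply/orP; right; rewrite sv ltnS.
  by case: (child_sizes v) => //= x s; rewrite leq_addl.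
- move=> c cv i0; have := nc c cv; have := hc c cv; rewrite i0 => z0 e.
  apply: (@leq_trans (((sumn (behead (child_sizes v))).+1 + #|subtree c|) * Y #|subtree v|)).
    by rewrite mulnDl leq_add2r.
  rewrite leq_mul2r; apply/orP; right; rewrite sv -e.
  by case: (child_sizes v) z0 => //= x s _; rewrite addSn addnC.
Qed.

(** The two sums differ by a shift; the extra last term for [v] is the offset of the root, which is
    0. *)
Lemma position_child c v : c \in children v -> position c = position v + offset c.
Proof.
rewrite in_children => /andP[_ /eqP pc]; rewrite /position.
have H m : 0 < m -> iter m par c = root ->
    \sum_(0 <= i < m) offset (iter i par c) = \sum_(0 <= i < m) offset (iter i par v) + offset c.
  case: m => // m _ cm; rewrite big_nat_recl // [in RHS]big_nat_recr //= addnC -pc -iterSr cm.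
  have -> : offset root = 0 by rewrite /offset eqxx.
  rewrite addn0; congr (_ + _).
  by apply: eq_bigr => i _; rewrite -iterS iterSr.
apply: H; last exact: iter_tn.
exact: leq_ltn_trans (ltn_ord root).
Qed.

Lemma offset_heavy c v : c \in children v -> index c (kids v) = 0 ->
  offset c = sumn (node_shape v).
Proof.
by rewrite in_children => /andP[cr /eqP pc] i0; rewrite /offset (negbTE cr) pc i0.
Qed.

Lemma offset_light c v : c \in children v -> 0 < index c (kids v) ->
  offset c = sumn (take (index c (kids v)) (node_shape v)).
Proof.
rewrite in_children => /andP[cr /eqP pc] i0; rewrite /offset (negbTE cr) pc.
by rewrite -(negbK (_ == 0)) -lt0n i0.
Qed.

Lemma sumn_take_nth (s : seq nat) j : sumn (take j.+1 s) = sumn (take j s) + nth 0 s j.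
Proof.
have [js|sj] := ltnP j (size s); first by rewrite (take_nth 0) // sumn_rcons.
by rewrite !take_oversize ?nth_default ?addn0 // ltnW.
Qed.

Lemma sumn_take_homo (s : seq nat) i j : i <= j -> sumn (take i s) <= sumn (take j s).
Proof.
move=> /subnK <-; elim: (j - i) => // k; rewrite addSn sumn_take_nth => h.
by apply: leq_trans h _; rewrite leq_addr.
Qed.

Lemma sumn_take_le (s : seq nat) j : sumn (take j s) <= sumn s.
Proof. by rewrite -[X in _ <= sumn X](cat_take_drop j) sumn_cat leq_addr. Qed.

Lemma offset_gt0 c v : c \in children v -> 0 < offset c.
Proof.
move=> cv; have [h1 _ _ _] := node_spec v.
have one : 1 <= sumn (take 1 (node_shape v)).
  by move: h1; case: (node_shape v) => //= x s ->.
have [i0|ip] := posnP (index c (kids v)).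
  by rewrite (offset_heavy cv i0); apply: leq_trans one (sumn_take_le _ _).
by rewrite (offset_light cv ip); apply: leq_trans one (sumn_take_homo _ _).
Qed.

Lemma card_child_lt c v : c \in children v -> #|subtree c| < #|subtree v|.
Proof.
move=> cv; apply: proper_card; apply/properP; split.
  by apply/subsetP => w wc; apply: subtree_trans wc (child_subtree cv).
by exists v; rewrite ?subtree_refl ?notin_child_subtree.
Qed.

Lemma node_ind (P : 'I_(tn T) -> Prop) :
  (forall v, (forall c, c \in children v -> P c) -> P v) -> forall v, P v.
Proof.
move=> H v; have [m] := ubnP #|subtree v|; elim: m v => // m IH v vm.
by apply: H => c cv; apply: IH; apply: leq_trans (card_child_lt cv) _.
Qed.

Lemma light_width c v : c \in children v -> 0 < index c (kids v) ->
  #|subtree c| * Y #|subtree c| <= nth 0 (node_shape v) (index c (kids v)).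
Proof.
move=> cv ip; have [_ h2 _ _] := node_spec v; have := h2 c cv ip.
set x := _ * Y _ => h; rewrite -(leq_pmul2l q_gt0); apply: leq_trans h.
by rewrite leq_mul2r leqnSn orbT.
Qed.

Lemma position_range v w : w \in subtree v ->
  position v <= position w /\ position w < position v + #|subtree v| * Y #|subtree v|.
Proof.
elim/node_ind: v w => v IH w wv.
have [->|nwv] := eqVneq w v.
  split=> //; rewrite -[ltnLHS]addn0 ltn_add2l muln_gt0 Y_gt0 andbT card_gt0.
  by apply/set0Pn; exists v; apply: subtree_refl.
have [c cv wc] := subtree_child wv nwv.
have [lo hi] := IH c cv w wc; rewrite (position_child cv) in lo hi.
have [h1 h2 h3 h4] := node_spec v.
split; first by apply: leq_trans lo; rewrite leq_addr.
have [i0|ip] := posnP (index c (kids v)).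
  rewrite (offset_heavy cv i0) in hi; apply: (leq_trans hi).
  rewrite -addnA leq_add2l; apply: leq_trans (h4 c cv i0).
  by rewrite leq_add2l leq_mul2l Y_homo ?orbT // ltnW // card_child_lt.
rewrite (offset_light cv ip) in hi; apply: (leq_trans hi).
rewrite -addnA leq_add2l; apply: leq_trans h3.
apply: leq_trans (sumn_take_le _ (index c (kids v)).+1); rewrite sumn_take_nth leq_add2l.
exact: light_width.
Qed.

Lemma extent_gt0 v : 0 < extent v.
Proof.
by apply: leq_trans (leq_bigmax_cond _ (subtree_refl v)).
Qed.

Lemma extent_le v : extent v <= #|subtree v| * Y #|subtree v|.
Proof.
apply/bigmax_leqP => w wv; have [lo hi] := position_range wv; lia.
Qed.

Lemma position_extent v w : w \in subtree v ->
  position v <= position w < position v + rnd (extent v).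
Proof.
move=> wv; have [lo _] := position_range wv; rewrite lo /=.
have h : (position w - position v).+1 <= extent v by rewrite /extent (bigD1 w) //= leq_maxl.
have := rnd_ge (extent v); lia.
Qed.

(** Overhangs of rounded intervals do not accumulate: along a heavy edge the allowance [1 / q] of
    the parent contains that of the child, and at a light edge the slack in the recorded length
    absorbs the overhang. *)
Lemma position_round v w : w \in subtree v ->
  q * (position w + rnd (extent w)) <= q * position v + q.+1 * (#|subtree v| * Y #|subtree v|).
Proof.
elim/node_ind: v w => v IH w wv.
have [->|nwv] := eqVneq w v.
  rewrite mulnDr leq_add2l; apply: leq_trans (rnd_le (extent_gt0 v)) _.
  by rewrite leq_mul2l extent_le orbT.
have [c cv wc] := subtree_child wv nwv.
apply: (leq_trans (IH c cv w wc)); rewrite (position_child cv).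
have [h1 h2 h3 h4] := node_spec v.
have [i0|ip] := posnP (index c (kids v)).
  rewrite (offset_heavy cv i0); have := h4 c cv i0.
  have : #|subtree c| * Y #|subtree c| <= #|subtree c| * Y #|subtree v|.
    by rewrite leq_mul2l Y_homo ?orbT // ltnW // card_child_lt.
  move: (_ * Y _) (_ * Y _) (_ * Y _) => x y z; nia.
rewrite (offset_light cv ip); have := h2 c cv ip.
have := leq_trans (sumn_take_le _ (index c (kids v)).+1) h3; rewrite sumn_take_nth.
move: (_ * Y _) (_ * Y _) (nth _ _ _) (sumn _) => x y z t; nia.
Qed.

Lemma light_round c v w : c \in children v -> 0 < index c (kids v) -> w \in subtree c ->
  position w + rnd (extent w) <= position v + sumn (take (index c (kids v)).+1 (node_shape v)).
Proof.
move=> cv ip wc; rewrite -(leq_pmul2l q_gt0); apply: (leq_trans (position_round wc)).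
rewrite (position_child cv) (offset_light cv ip) sumn_take_nth addnA [leqRHS]mulnDr leq_add2l.
by have [_ h2 _ _] := node_spec v; apply: h2.
Qed.

Lemma light_position c v w : c \in children v -> 0 < index c (kids v) -> w \in subtree c ->
  exists2 d, d < nth 0 (node_shape v) (index c (kids v)) &
    position w = position v + sumn (take (index c (kids v)) (node_shape v)) + d.
Proof.
move=> cv ip wc; have [lo hi] := position_range wc; have := light_width cv ip.
move: lo hi; rewrite (position_child cv) (offset_light cv ip).
set x := _ + sumn _ => lo hi h; exists (position w - x); lia.
Qed.

Lemma heavy_position c v w : c \in children v -> index c (kids v) = 0 -> w \in subtree c ->
  position v + sumn (node_shape v) <= position w.
Proof.
move=> cv i0 wc; have [lo _] := position_range wc.
by rewrite (position_child cv) (offset_heavy cv i0) in lo.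
Qed.

(** Rounded intervals in a light subtree stay inside its entry. Those in the heavy subtree may stick
    out to the right, but all its siblings lie to the left. *)
Lemma siblings_disjoint v c1 c2 u w : c1 \in children v -> c2 \in children v -> c1 != c2 ->
  u \in subtree c1 -> w \in subtree c2 ->
  ~~ (position u <= position w < position u + rnd (extent u)).
Proof.
move=> h1 h2 c12 uc wc; apply/negP => /andP[lo hi].
have ne : index c1 (kids v) != index c2 (kids v).
  apply: contra c12 => /eqP e; apply/eqP.
  by rewrite -(nth_index v (s := kids v) (x := c1)) ?mem_kids // e nth_index ?mem_kids.
have [i1|p1] := posnP (index c1 (kids v)).
  have p2 : 0 < index c2 (kids v) by rewrite i1 in ne; rewrite lt0n eq_sym.
  have a := heavy_position h1 i1 uc; have [d d1 d2] := light_position h2 p2 wc.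
  have := sumn_take_le (node_shape v) (index c2 (kids v)).+1; rewrite sumn_take_nth; lia.
have b := light_round h1 p1 uc.
have [i2|p2] := posnP (index c2 (kids v)).
  have a := heavy_position h2 i2 wc.
  have := sumn_take_le (node_shape v) (index c1 (kids v)).+1; lia.
have [d d1 d2] := light_position h2 p2 wc.
have [d' d1' d2'] := light_position h1 p1 uc.
have [lt|lt|e] := ltngtP (index c1 (kids v)) (index c2 (kids v)); last by rewrite e eqxx in ne.
  have := sumn_take_homo (node_shape v) lt; lia.
have := sumn_take_homo (node_shape v) lt; rewrite sumn_take_nth; lia.
Qed.

(** Descend from the root while both nodes lie below the same child. Either they separate into
    siblings, or [w] is a proper ancestor of [u] and has a smaller position. *)
Lemma position_outside u w : w \notin subtree u ->
  ~~ (position u <= position w < position u + rnd (extent u)).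
Proof.
move=> wu.
have rt x : x \in subtree root by apply/in_subtree; exists (tn T); apply: iter_tn.
move: (rt u) (rt w); elim/node_ind: root => v IH uv wv.
have [uE|nuv] := eqVneq u v; first by rewrite uE wv in wu.
have [c1 c1v uc1] := subtree_child uv nuv.
have [wE|nwv] := eqVneq w v.
  rewrite wE; have [lo _] := position_range uc1; rewrite (position_child c1v) in lo.
  have op := offset_gt0 c1v; rewrite negb_and -ltnNge; apply/orP; left; lia.
have [c2 c2v wc2] := subtree_child wv nwv.
have [e|ne] := eqVneq c1 c2; first by apply: (IH c1); rewrite // e.
exact: siblings_disjoint c1v c2v ne uc1 wc2.
Qed.

Lemma route_correct u w : u != w ->
  route_ok cport u w (route (position u) (position w) (rnd (extent u)) (node_shape u)).
Proof.
move=> nuw; rewrite /route.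
case: (boolP (w \in subtree u)) => wu; last first.
  by left; split=> //; rewrite (negbTE (position_outside wu)).
rewrite (position_extent wu) /=.
have [c cu wc] : exists2 c, c \in children u & w \in subtree c.
  by apply: subtree_child wu _; rewrite eq_sym.
right; exists c; split=> //.
have pc : par c = u by move: cu; rewrite in_children => /andP[_ /eqP].
rewrite /cport pc; have [i0|ip] := posnP (index c (kids u)).
  by rewrite i0 ifT //; have := heavy_position cu i0 wc; lia.
have [d d1 ->] := light_position cu ip wc.
rewrite -addnA addKn ifF; first by rewrite -/(flatten_index _ _ _) flatten_indexKl.
apply/negbTE; rewrite -ltnNge.
have := sumn_take_le (node_shape u) (index c (kids u)).+1; rewrite sumn_take_nth.
by apply: leq_trans; rewrite ltn_add2l.
Qed.

End Layout.
End Tree.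

(** * The labels and their length *)

Definition round_up q x := grid q 0 (grid_index q 0 x).

Lemma round_up_ge q x : x <= round_up q x.
Proof. exact: grid_indexP. Qed.

Lemma round_up_le q x : 0 < x -> q * round_up q x <= q.+1 * x.
Proof.
move=> x0; apply: (@leq_trans (q * (x + x %/ q))); first by rewrite leq_mul2l grid_roundup ?orbT.
by rewrite mulnDr mulSn addnC leq_add2r mulnC leq_trunc_div.
Qed.

Section Scheme.

(** The rate depends on [l] alone, so the decoder knows it. *)
Variable (qf : nat -> nat).
Hypothesis qf_gt0 : forall l, 0 < qf l.

(** This bounds [n * budget n] for [n <= 2 ^ l]; [ext_bound] is the matching bound from
    [grid_index_bound] with base 0. *)
Definition position_bound l := 2 ^ l * growth (qf l) l.+1.
Definition ext_bound l := (prec (qf l) * up_log 2 (position_bound l)).+1.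

Definition label l := ('I_(position_bound l).+1 * 'I_(ext_bound l).+1 * code (qf l) l)%type.

Definition width l :=
  (l + up_log 2 (growth (qf l) l.+1)).+1 + up_log 2 (ext_bound l).+1 +
  2 * up_log 2 l.+1 + tabsize (qf l) l * (tablog (qf l) l).+1.

Lemma card_label l : #|{: label l}| <= 2 ^ width l.
Proof.
rewrite !card_prod card_ffun !card_ord /width.
have h1 : (position_bound l).+1 <= 2 ^ (l + up_log 2 (growth (qf l) l.+1)).+1.
  have a1 : position_bound l <= 2 ^ (l + up_log 2 (growth (qf l) l.+1)).
    by rewrite /position_bound expnD leq_mul2l up_logP ?orbT.
  rewrite expnS mul2n -addnn -addn1; apply: leq_add => //.
  by rewrite expn_gt0.
have h2 := up_logP (ext_bound l).+1 (isT : 1 < 2).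
have h3 : l.+1 * l.+1 <= 2 ^ (2 * up_log 2 l.+1).
  by rewrite mul2n -addnn expnD; apply: leq_mul; apply: up_logP.
have h4 : (2 ^ tablog (qf l) l).+1 ^ tabsize (qf l) l <=
    2 ^ (tabsize (qf l) l * (tablog (qf l) l).+1).
  rewrite mulnC expnM leq_exp2r // expnS mul2n -addnn -addn1 leq_add2l.
  by rewrite expn_gt0.
rewrite !(expnD 2 (_ + _)) expnD -[leqRHS]mulnA.
by apply: leq_mul; apply: leq_mul.
Qed.

Definition node_label (T : rtree) (l : nat) (v : 'I_(tn T)) : label l :=
  (inord (position (@code_shape (qf l) l) (encode (qf l) l) v),
   inord (grid_index (prec (qf l)) 0 (extent (@code_shape (qf l) l) (encode (qf l) l) v)),
   node_code (encode (qf l) l) v).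

Definition tree_encoder : encoder := fun T =>
  (fun v => bits (width (up_log 2 (tn T))) (node_label (up_log 2 (tn T)) v), @cport T).

Definition tree_decoder : decoder := fun x y l =>
  match unbits (label l) (width l) x, unbits (label l) (width l) y with
  | Some a, Some b =>
      route a.1.1 b.1.1 (grid (prec (qf l)) 0 a.1.2) (code_shape a.2)
  | _, _ => 0
  end.

Lemma tree_decoderE l (a b : label l) :
  tree_decoder (bits (width l) a) (bits (width l) b) l =
  route a.1.1 b.1.1 (grid (prec (qf l)) 0 a.1.2) (code_shape a.2).
Proof. by rewrite /tree_decoder !bitsK // card_label. Qed.

Lemma tree_scheme : routing_scheme tree_encoder tree_decoder.
Proof.
split=> [T|T u w nuw]; first exact: cport_valid.
set l := up_log 2 (tn T).
have nl : tn T <= 2 ^ l by apply: up_logP.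
have Y_gt0 m : 0 < budget (qf l) m.
  by apply: leq_trans (growth_ge _ _); rewrite muln_gt0 qf_gt0.
have Yh := @budget_homo (qf l).
have spec m s : antitone_seq s -> (forall j, j < size s -> 0 < nth 0 s j) ->
    (forall j, 2 * nth 0 s j <= m) -> (sumn s).+1 <= m -> m <= tn T ->
    [/\ nth 0 (code_shape (encode (qf l) l m s)) 0 = 1,
      forall j, j < size s ->
        (prec (qf l)).+1 * (nth 0 s j * budget (qf l) (nth 0 s j)) <=
        prec (qf l) * nth 0 (code_shape (encode (qf l) l m s)) j.+1
    & sumn (code_shape (encode (qf l) l m s)) <= (sumn s).+1 * budget (qf l) m].
  move=> an sp sh sm mT; have ml := leq_trans mT nl.
  rewrite shape_encode //; split=> // [j js|].
    exact: lens_cover.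
  exact: lens_total.
have q0 : 0 < prec (qf l) by rewrite muln_gt0 qf_gt0.
have Yl (v : 'I_(tn T)) : #|subtree v| * budget (qf l) #|subtree v| <= position_bound l.
  have cv : #|subtree v| <= 2 ^ l.
    exact: leq_trans (card_subtree_le v) nl.
  apply: leq_mul => //; apply: growth_homo.
  by rewrite ltnS -[leqRHS](@trunc_expnK 2 l) // leq_trunc_log.
have ext (v : 'I_(tn T)) : extent (@code_shape (qf l) l) (encode (qf l) l) v <= position_bound l.
  by apply: leq_trans (Yl v); apply: extent_le spec v.
have pl (v : 'I_(tn T)) :
    position (@code_shape (qf l) l) (encode (qf l) l) v < (position_bound l).+1.
  have vr : v \in subtree (troot T) by apply/in_subtree; exists (tn T); apply: iter_tn.
  have [_ hi] := position_range q0 Y_gt0 Yh spec vr.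
  rewrite ltnS; apply: ltnW; apply: leq_trans hi _.
  by rewrite /position big1 ?add0n // => i _; rewrite iter_root /offset eqxx.
have el (v : 'I_(tn T)) :
    grid_index (prec (qf l)) 0 (extent (@code_shape (qf l) l) (encode (qf l) l) v)
    < (ext_bound l).+1.
  rewrite ltnS; apply: grid_index_bound => //; rewrite muln1.
  by apply: leq_trans (ext v) (up_logP _ _).
change (route_ok (@cport T) u w (tree_decoder (bits (width l) (node_label l u))
  (bits (width l) (node_label l w)) l)).
rewrite tree_decoderE.
have -> : route (node_label l u).1.1 (node_label l w).1.1
    (grid (prec (qf l)) 0 (node_label l u).1.2) (code_shape (node_label l u).2) =
  route (position (@code_shape (qf l) l) (encode (qf l) l) u)
    (position (@code_shape (qf l) l) (encode (qf l) l) w)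
    (round_up (prec (qf l)) (extent (@code_shape (qf l) l) (encode (qf l) l) u))
    (node_shape (@code_shape (qf l) l) (encode (qf l) l) u).
  congr (route _ _ (grid _ 0 _) _).
  - exact: inordK (pl u).
  - exact: inordK (pl w).
  - exact: inordK (el u).
exact: (@route_correct T _ _ _ _ _ _ q0 Y_gt0 Yh (@round_up_ge _) (@round_up_le _) spec).
Qed.

Lemma tree_canonical : canonical_scheme tree_encoder.
Proof. move=> T; exact: cport_canonical. Qed.

Lemma size_label (T : rtree) (u : 'I_(tn T)) :
  size ((tree_encoder T).1 u) = width (up_log 2 (tn T)).
Proof. by rewrite size_bits // card_label. Qed.

End Scheme.

(** * Growth, choice of the rate, and the resulting width *)

(** Values are at least [prec q], so a step multiplies by at most [1 + 2 / q]. While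
    [4 * j <= q + 4], the effect of [j] steps stays below the linear bound [1 + 4 * j / q], which is
    at most 8 in this range. *)
Lemma growth_slow q i : 0 < q -> growth q (i + (q %/ 4).+1) <= 2 ^ 3 * growth q i.
Proof.
move=> q0.
have H j : 4 * j <= q + 4 -> q * growth q (i + j) <= (q + 4 * j) * growth q i.
  elim: j => [|j IH] hj; first by rewrite addn0 muln0 addn0.
  have h1 : q * growth q (i + j) <= (q + 4 * j) * growth q i by apply: IH; lia.
  have e : growth q (i + j.+1) = (growth q (i + j) + growth q (i + j) %/ q).+1.
    by rewrite addnS.
  have g := growth_ge q (i + j).
  have d := leq_trunc_div (growth q (i + j)) q.
  have h2 : q * growth q (i + j.+1) <= q.+2 * growth q (i + j).
    by rewrite e; move: g d; rewrite /prec; nia.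
  rewrite -(leq_pmul2l q0); apply: (@leq_trans (q.+2 * (q * growth q (i + j)))).
    by rewrite mulnCA leq_mul2l h2 orbT.
  apply: (@leq_trans (q.+2 * ((q + 4 * j) * growth q i))); first by rewrite leq_mul2l h1 orbT.
  by rewrite !mulnA leq_mul2r; apply/orP; right; nia.
have hq := leq_trunc_div q 4; set h := q %/ 4 in hq *.
have H' : q * growth q (i + h.+1) <= (q + 4 * h.+1) * growth q i.
  by apply: (H h.+1); lia.
rewrite -(leq_pmul2l q0); apply: (leq_trans H'); rewrite mulnA leq_mul2r.
by apply/orP; right; rewrite -[2 ^ 3]/8; lia.
Qed.

Lemma growth_up_log q i : 0 < q ->
  up_log 2 (growth q i) <= 3 * (i %/ (q %/ 4).+1).+1 + up_log 2 (prec q).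
Proof.
move=> q0; set h := (q %/ 4).+1.
have H m : growth q (m * h) <= 2 ^ (3 * m) * prec q.
  elim: m => [|m IH]; first by rewrite mul1n.
  rewrite mulSn addnC mulnS expnD; apply: (leq_trans (growth_slow _ q0)).
  by rewrite -mulnA leq_mul2l IH orbT.
apply: up_log_min => //.
apply: (@leq_trans (growth q ((i %/ h).+1 * h))).
  by apply: growth_homo; apply: ltnW; apply: ltn_ceil.
apply: (leq_trans (H _)); rewrite expnD leq_mul2l; apply/orP; right; exact: up_logP.
Qed.

Definition lsize l := (trunc_log 2 l).+1.

Lemma root4_exists l : exists x, l < x.+1 ^ 4 * lsize l ^ 2.
Proof.
exists l; apply: (@leq_trans (l.+1 ^ 4)); last by rewrite leq_pmulr // expn_gt0.
by rewrite -[leqLHS]expn1 leq_pexp2l.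
Qed.

(* The integer part of [l^(1/4) / (log l)^(1/2)], with [lsize l] for [log l]. *)
Definition root4 l := ex_minn (root4_exists l).
Definition rate l := maxn 1 (root4 l).

Lemma rate_gt0 l : 0 < rate l. Proof. by rewrite leq_max. Qed.

Lemma sq_le_exp m : 7 <= m -> m ^ 2 <= 2 ^ m.-1.
Proof.
elim: m => // m IH; rewrite leq_eqVlt => /orP[/eqP<- //|m7].
have := IH m7; case: m m7 {IH} => // m m7; rewrite /= [2 ^ m.+1]expnS => IH.
apply: leq_trans (_ : 2 * m.+1 ^ 2 <= _); last by rewrite leq_mul2l.
rewrite !expnS expn0; nia.
Qed.

Lemma lsize_gt l : l < 2 ^ lsize l.
Proof. exact: trunc_log_ltn. Qed.

(** [64 = 2 ^ 6] gives [lsize l >= 7], where [sq_le_exp] starts. *)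
Lemma lsize_sq l : 64 <= l -> lsize l ^ 2 <= l.
Proof.
move=> l64; have l7 : 7 <= lsize l.
  by rewrite ltnS; apply: trunc_log_max.
apply: leq_trans (sq_le_exp l7) _; apply: trunc_logP => //.
exact: leq_trans l64.
Qed.

(** The first bound is the minimality of [root4]; the second follows from [x.+1 <= 2 * x]. *)
Lemma rate_bounds l : 64 <= l ->
  rate l ^ 4 * lsize l ^ 2 <= l /\ l < 16 * (rate l ^ 4 * lsize l ^ 2).
Proof.
move=> l64; have sq := lsize_sq l64.
rewrite /rate /root4; case: ex_minnP => x lx xmin.
have x0 : 0 < x.
  by rewrite lt0n; apply/eqP => x0; move: lx; rewrite x0 exp1n mul1n ltnNge sq.
rewrite (maxn_idPr x0); split.
  rewrite leqNgt; apply/negP => lx'; have := xmin x.-1; rewrite prednK // => /(_ lx').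
  by case: (x) x0 => // y _; rewrite ltnn.
apply: leq_trans lx _; rewrite mulnA leq_mul2r; apply/orP; right.
by rewrite -[16]/(2 ^ 4) -expnMn leq_exp2r //; lia.
Qed.

(** [m] accounts for the logarithm of the growth, of order [l / rate l], and the last term for the
    table of counts. *)
Lemma width_bound l : 64 <= l ->
  exists m, rate l * m <= 27 * l /\
    width rate l <= l + m + 18 * lsize l + 729 * (rate l ^ 3 * lsize l ^ 2).
Proof.
move=> l64; set q := rate l; set t := lsize l.
have q0 : 0 < q := rate_gt0 l.
have t0 : 0 < t by [].
have lt := lsize_gt l; rewrite -/t in lt.
have [b1 b2] := rate_bounds l64; rewrite -/q -/t in b1 b2.
have ql : q <= l.
  apply: leq_trans b1; apply: (@leq_trans (q ^ 4)); first by rewrite -[leqLHS]expn1 leq_pexp2l.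
  by rewrite leq_pmulr // expn_gt0 t0.
(* [30 <= 2 ^ 5], and both [q] and [l.+1] are at most [2 ^ t]. *)
have td : tabdrop q l <= 7 * t.
  apply: up_log_min => //; apply: (@leq_trans (2 ^ (5 + t + t))); last by rewrite leq_exp2l //; lia.
  rewrite !expnD; apply: leq_mul => //; apply: leq_mul => //.
  exact: leq_trans ql (ltnW lt).
have tl : tablog q l <= 8 * (q * t).
  have : q * tabdrop q l <= q * (7 * t) by rewrite leq_mul2l td orbT.
  rewrite /tablog; move: (tabdrop q l) => d; nia.
have ts : tabsize q l <= 81 * (q ^ 2 * t).
  have : prec q * tablog q l <= 10 * q * (8 * (q * t)) by apply: leq_mul.
  rewrite /tabsize; move: (tablog q l) => d; nia.
have tt : tabsize q l * (tablog q l).+1 <= 729 * (q ^ 3 * t ^ 2).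
  apply: (@leq_trans (81 * (q ^ 2 * t) * (9 * (q * t)))); last by rewrite !expnS; nia.
  by apply: leq_mul => //; move: (tablog q l) tl => d; nia.
set m := (l.+1 %/ (q %/ 4).+1).+1; exists (3 * m).
have mq : q * m <= 9 * l.
  have d1 := leq_trunc_div l.+1 (q %/ 4).+1.
  have d2 := ltn_ceil q (isT : 0 < 4).
  rewrite /m; move: (q %/ 4) (l.+1 %/ _) d1 d2 => y x d1 d2; nia.
split; first by rewrite mulnCA; lia.
have p : up_log 2 (prec q) <= 4 + t.
  apply: up_log_min => //; rewrite expnD; apply: leq_mul => //.
  exact: leq_trans ql (ltnW lt).
have g : up_log 2 (growth q l.+1) <= 3 * m + (4 + t).
  by apply: (leq_trans (growth_up_log _ q0)); rewrite leq_add2l.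
have ml : m <= l.+2 by rewrite ltnS leq_div.
have tl' : t <= l.+1.
  rewrite /t /lsize ltnS; apply: leq_trans (ltnW (ltn_expl _ (isT : 1 < 2))) _.
  by apply: trunc_logP => //; apply: leq_trans l64.
have ub : up_log 2 l.+1 <= t by apply: up_log_min.
have eb : up_log 2 (ext_bound rate l).+1 <= 2 * t + 8.
  apply: up_log_min => //; rewrite /ext_bound -/q.
  have a1 : up_log 2 (position_bound rate l) <= 16 * l.
    apply: (@leq_trans (l + (3 * m + (4 + t)))); last by lia.
    apply: up_log_min => //; rewrite /position_bound expnD leq_mul2l -/q; apply/orP; right.
    by apply: leq_trans (up_logP _ (isT : 1 < 2)) _; rewrite leq_exp2l.
  apply: (@leq_trans (2 ^ t * 2 ^ t * 2 ^ 8)); last by rewrite -!expnD leq_exp2l //; lia.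
  have a2 : prec q * up_log 2 (position_bound rate l) <= 10 * l * (16 * l).
    by apply: leq_mul => //; rewrite leq_mul2l ql.
  have ll := leq_mul (ltnW lt) (ltnW lt); have l1 : l <= l * l by rewrite leq_pmull //; lia.
  move: (prec q * _) (2 ^ t * 2 ^ t) a2 ll => x y; rewrite -[2 ^ 8]/256; lia.
(* The terms besides [l], the growth and the table add up to [5 * t + 13 <= 18 * t]. *)
rewrite /width -/q; move: tt g eb ub.
move: (tabsize q l * _) (up_log 2 (growth _ _)) (up_log 2 (ext_bound _ _).+1) (up_log 2 l.+1).
move: (q ^ 3 * t ^ 2) => x1 x2 x3 x4 x5; lia.
Qed.

(** * Real estimates of the width *)

Section RealBounds.
Local Open Scope R_scope.

Lemma INR_mul m n : INR (m * n)%N = INR m * INR n.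
Proof. exact: mult_INR. Qed.

Lemma INR_add m n : INR (m + n)%N = INR m + INR n.
Proof. exact: plus_INR. Qed.

Lemma INR_exp m n : INR (m ^ n)%N = INR m ^ n.
Proof. by elim: n => [|n IH] //; rewrite expnS INR_mul IH. Qed.

Lemma INR_le (m n : nat) : (m <= n)%N -> INR m <= INR n.
Proof. by move/leP; apply: le_INR. Qed.

Lemma pow4_le_inv x y : 0 <= y -> x ^ 4 <= y ^ 4 -> x <= y.
Proof.
move=> y0 h; apply: Rnot_lt_le => yx.
have y2 : y * y < x * x by nra.
have : (y * y) * (y * y) < (x * x) * (x * x) by nra.
by move: h => /=; lra.
Qed.

Lemma Rpower_quarter x : 0 < x -> Rpower x (1 / 4) ^ 4 = x.
Proof.
move=> x0; rewrite -Rpower_pow; last exact: exp_pos.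
by rewrite Rpower_mult (_ : 1 / 4 * INR 4 = 1) ?Rpower_1 //=; field.
Qed.

Lemma Rpower_three_quarters x : 0 < x -> Rpower x (3 / 4) = Rpower x (1 / 4) ^ 3.
Proof.
move=> x0; rewrite -Rpower_pow; last exact: exp_pos.
by rewrite Rpower_mult (_ : 1 / 4 * INR 3 = 3 / 4) //=; field.
Qed.

Lemma ln2_gt0 : 0 < ln 2.
Proof. by rewrite -ln_1; apply: ln_increasing; lra. Qed.

Lemma log2_pow k : log2 (INR (2 ^ k)%N) = INR k.
Proof.
have l2 := ln2_gt0.
rewrite INR_exp (_ : INR 2 = 2) // /log2 ln_pow; last lra.
by field; lra.
Qed.

Lemma log2_le x y : 0 < x -> x <= y -> log2 x <= log2 y.
Proof.
move=> x0 xy; have l2 := ln2_gt0; apply: Rmult_le_compat_r.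
  by apply/Rlt_le/Rinv_0_lt_compat.
by case: xy => [xy|->]; [left; apply: ln_increasing | right].
Qed.

Lemma log2_double x : 0 < x -> log2 (2 * x) = 1 + log2 x.
Proof.
move=> x0; have l2 := ln2_gt0; rewrite /log2 ln_mult //; last lra.
by field; lra.
Qed.

(** With [a] the fourth root of [l] and [s] the square root of [lsize l], the rate is [a / s] up to
    a factor 2. Each error term is then a multiple of [a ^ 3 * s], and [801 = 54 + 18 + 729]. *)
Lemma width_real l : (64 <= l)%N ->
  INR (width rate l) <= INR l + 801 * (Rpower (INR l) (1 / 4) ^ 3 * sqrt (INR (lsize l))).
Proof.
move=> l64; have [m [m1 m2]] := width_bound l64.
have [b1 b2] := rate_bounds l64; have q0 := rate_gt0 l.
have t0 : (0 < lsize l)%N by [].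
move: m1 m2 b1 b2 q0 t0; set q := rate l; set t := lsize l => m1 m2 b1 b2 q0 t0.
have L1 : 1 <= INR l by apply: (INR_le (m := 1)); apply: leq_trans l64.
set a := Rpower _ _; set s := sqrt _.
have a4 : a ^ 4 = INR l by apply: Rpower_quarter; lra.
have a0 : 0 < a by apply: exp_pos.
have T1 : 1 <= INR t by apply: (INR_le (m := 1)).
have Q1 : 1 <= INR q by apply: (INR_le (m := 1)).
have s2 : s ^ 2 = INR t by rewrite /= Rmult_1_r /s sqrt_sqrt //; lra.
have s0 : 0 <= s by apply: sqrt_pos.
have s1 : 1 <= s by nra.
have c1 : INR q * s <= a.
  apply: pow4_le_inv; first lra.
  have := INR_le b1; rewrite INR_mul (INR_exp q) (INR_exp t) -s2 -a4; lra.
have c2 : a <= 2 * (INR q * s).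
  apply: pow4_le_inv; first nra.
  have := INR_le (ltnW b2); rewrite (INR_mul 16) (INR_mul (q ^ 4)) (INR_exp q) (INR_exp t)
    -s2 -a4 (_ : INR 16 = 16); last by rewrite /=; lra.
  lra.
have a1 : 1 <= a by nra.
have X0 : 0 <= a ^ 3 * s by apply: Rmult_le_pos => //; apply: pow_le; lra.
have d1 : INR q ^ 3 * INR t ^ 2 <= a ^ 3 * s.
  rewrite -s2 (_ : INR q ^ 3 * (s ^ 2) ^ 2 = (INR q * s) ^ 3 * s); last by ring.
  apply: Rmult_le_compat_r => //; apply: pow_incr; split=> //; nra.
have d2 : INR t <= a ^ 3 * s.
  rewrite -s2 (_ : s ^ 2 = s * s); last by ring.
  apply: Rmult_le_compat_r => //; have sa : s <= a by nra.
  have aa : 1 <= a * a by nra.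
  rewrite (_ : a ^ 3 = a * (a * a)); last by ring.
  nra.
have d3 : INR m <= 54 * (a ^ 3 * s).
  have := INR_le m1;
    rewrite (INR_mul q) (INR_mul 27) -a4 (_ : INR 27 = 27); last by rewrite /=; lra.
  move=> h; apply: (Rmult_le_reg_l (INR q)); first lra.
  apply: (Rle_trans _ _ _ h).
  rewrite (_ : INR q * (54 * (a ^ 3 * s)) = 27 * (a ^ 3 * (2 * (INR q * s)))); last by ring.
  apply: Rmult_le_compat_l; first lra.
  rewrite (_ : a ^ 4 = a ^ 3 * a); last by ring.
  by apply: Rmult_le_compat_l => //; apply: pow_le; lra.
have := INR_le m2; rewrite (INR_add (l + m + 18 * t)) (INR_add (l + m)) (INR_add l)
  (INR_mul 18) (INR_mul 729) (INR_mul (q ^ 3)) (INR_exp q) (INR_exp t).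
rewrite (_ : INR 18 = 18); last by rewrite /=; lra.
rewrite (_ : INR 729 = 729); last by rewrite INR_IZR_INZ.
lra.
Qed.

(** Replacing [l] by [log2 n] costs at most 1 in the main term, 8 in the cubed fourth root and 2 in
    the square root: [12817 = 801 * 16 + 1]. *)
Lemma width_len_bound n : (2 ^ 64 <= n)%N ->
  INR (width rate (up_log 2 n)) <= len_bound 12817 n.
Proof.
move=> n64; set l := up_log 2 n.
have l64 : (64 <= l)%N.
  by move: n64; move: (64%N) => k nk; rewrite /l -[k](@up_expnK 2 k) // leq_up_log.
have n0 : (0 < n)%N by apply: leq_trans n64; rewrite expn_gt0.
have lL : INR l <= log2 (INR n) + 1.
  have := @up_log_gtn 2 n isT; rewrite -/l; case: l l64 => // l' l64; rewrite [l'.+1.-1]/=.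
  have n1 : (1 < n)%N by
    apply: leq_trans n64; apply: (leq_trans (ltn_expl 1 (isT : (1 < 2)%N))); rewrite leq_exp2l.
  move=> /(_ n1) /ltnW h; rewrite S_INR -(log2_pow l'); apply: Rplus_le_compat_r.
  apply: log2_le; last exact: INR_le.
  by apply: lt_0_INR; apply/ltP; rewrite expn_gt0.
have Ll : log2 (INR n) <= INR l.
  rewrite -(log2_pow l); apply: log2_le; first by apply: lt_0_INR; apply/ltP.
  by apply: INR_le; apply: up_logP.
have l64R : 64 <= INR l by have := INR_le l64; rewrite (_ : INR 64 = 64) //; rewrite INR_IZR_INZ.
rewrite /len_bound; move: lL Ll; set L := log2 (INR n) => lL Ll.
have L63 : 63 <= L by lra.
have LL1 : 1 <= log2 L.
  have -> : 1 = log2 2 by rewrite /log2; field; have := ln2_gt0; lra.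
  by apply: log2_le; lra.
have tL : INR (lsize l) <= 4 * log2 L.
  rewrite /lsize S_INR; have : INR (trunc_log 2 l) <= log2 (INR l).
    rewrite -log2_pow; apply: log2_le.
      by apply: lt_0_INR; apply/ltP; rewrite expn_gt0.
    by apply: INR_le; apply: trunc_logP => //; apply: leq_trans l64.
  have : log2 (INR l) <= log2 (2 * L) by apply: log2_le; lra.
  rewrite log2_double; lra.
apply: (Rle_trans _ _ _ (width_real l64)).
rewrite Rpower_three_quarters; last lra.
set a := Rpower (INR l) _; set b := Rpower L _.
have a0 : 0 < a by apply: exp_pos.
have b0 : 0 < b by apply: exp_pos.
have b4 : b ^ 4 = L by apply: Rpower_quarter; lra.
have ab : a <= 2 * b.
  apply: pow4_le_inv; first lra.
  rewrite Rpower_quarter; last lra.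
  rewrite (_ : (2 * b) ^ 4 = 16 * b ^ 4); last by ring.
  rewrite b4; lra.
have b1 : 1 <= b by apply: pow4_le_inv; lra.
set r := sqrt (log2 L).
have r1 : 1 <= r by rewrite -sqrt_1; apply: sqrt_le_1; lra.
have sr : sqrt (INR (lsize l)) <= 2 * r.
  have -> : 2 * r = sqrt (4 * log2 L).
    rewrite sqrt_mult; [|lra|lra]; congr (_ * _).
    by rewrite (_ : 4 = 2 * 2) ?sqrt_square //; lra.
  by apply: sqrt_le_1 => //; [apply: pos_INR | lra].
have a3 : a ^ 3 <= 8 * b ^ 3.
  rewrite (_ : 8 * b ^ 3 = (2 * b) ^ 3); last by ring.
  by apply: pow_incr; lra.
have b3 : 1 <= b ^ 3 by apply: pow_R1_Rle.
have X : a ^ 3 * sqrt (INR (lsize l)) <= 8 * b ^ 3 * (2 * r).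
  apply: Rmult_le_compat => //; first by apply: pow_le; lra.
  exact: sqrt_pos.
nra.
Qed.

Lemma width_asymptotics : exists (C : R) (N0 : nat), forall n, (N0 <= n)%N ->
  INR (width rate (up_log 2 n)) <= len_bound C n.
Proof. by exists 12817, (2 ^ 64)%N; apply: width_len_bound. Qed.

End RealBounds.

Theorem mainTheorem2 :
  exists (enc : encoder) (dec : decoder),
    routing_scheme enc dec /\ canonical_scheme enc /\
    exists (C : R) (N0 : nat),
      forall T : rtree, N0 <= tn T ->
        forall u : 'I_(tn T), Rle (INR (size ((enc T).1 u))) (len_bound C (tn T)).
Proof.
exists (tree_encoder rate), (tree_decoder rate).
split; first exact: tree_scheme rate_gt0.
split; first exact: tree_canonical.
have [C [N0 bound]] := width_asymptotics.
by exists C, N0 => T nT u; rewrite size_label; apply: bound.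
Qed.
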